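(* Let $X$ be an infinite set whose cardinality is a regular cardinal. Assume that $\mathscr{C}\subseteq\mathscr{O}$ is a precomplete clone on $X$ with $\mathscr{O}^{(1)}\subseteq\mathscr{C}$ and $\mathscr{C}^{(2)}\subseteq\mathscr{U}^{(2)}$. Then $\mathscr{C}=\operatorname{Pol}\mathscr{U}^{(2)}$.
   Context: $\mathscr{O}^{(n)}$ is the set of all functions $X^n\to X$ ($n\ge1$), $\mathscr{O}=\bigcup_{n\ge1}\mathscr{O}^{(n)}$. A clone on $X$ is a set $\mathscr{C}\subseteq\mathscr{O}$ containing all projections $\pi^n_k(x_1,\dots,x_n)=x_k$ and closed under composition (if $f_1,\dots,f_k\in\mathscr{C}$ are $n$-ary and $g\in\mathscr{C}$ is $k$-ary, then $g(f_1,\dots,f_k)\in\mathscr{C}$). A clone $\mathscr{C}\neq\mathscr{O}$ is precomplete if the only clone properly containing it is $\mathscr{O}$. $\mathscr{C}^{(n)}=\mathscr{C}\cap\mathscr{O}^{(n)}$. A set is small if its cardinality is smaller than $|X|$. A function $g:X^n\to X$ is almost unary if there are $k\in\{1,\dots,n\}$ and a function $G$ on $X$, with each $G(x)$ a small subset of $X$, such that $g(x_1,\dots,x_n)\in G(x_k)$ for all $(x_1,\dots,x_n)\in X^n$. $\mathscr{U}\subseteq\mathscr{O}$ is the set of all almost unary functions, and $\mathscr{U}^{(2)}=\mathscr{U}\cap\mathscr{O}^{(2)}$. $\operatorname{Pol}\mathscr{U}^{(2)}$ is the set of all $f\in\mathscr{O}$ such that, if $f$ is $n$-ary, then for all $g_1,\dots,g_n\in\mathscr{U}^{(2)}$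 the function $(x,y)\mapsto f(g_1(x,y),\dots,g_n(x,y))$ is in $\mathscr{U}^{(2)}$. *)

(* Defs.v *)
From mathcomp Require Import all_boot.
From mathcomp Require Import boolp classical_sets functions cardinality wochoice.

Set Implicit Arguments.
Unset Strict Implicit.
Unset Printing Implicit Defensive.

Local Open Scope classical_set_scope.
Local Open Scope card_scope.

Section Cardinality.
Variable X : Type.

Definition small (A : set X) : Prop := A #<= [set: X] /\ A #!= [set: X].

(* R well-orders X with order type the initial ordinal of |X|: it is a
   well-order all of whose proper initial segments are small. *)
Definition initial_well_order (R : rel X) : Prop :=
  well_order R /\ forall x, small [set y | R y x /\ y <> x].

Definition cofinal (R : rel X) (A : set X) : Prop :=
  forall x, exists2 a, A a & R x a.

(* |X| is an infinite cardinal equal to its own cofinality: once X is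
   identified with the initial ordinal |X|, every cofinal subset has
   cardinality |X|. *)
Definition regular_cardinality : Prop :=
  infinite_set [set: X] /\
  exists2 R : rel X, initial_well_order R &
    forall A : set X, cofinal R A -> A #= [set: X].

End Cardinality.

Section Clones.
Variable X : Type.

Definition op (n : nat) : Type := ('I_n -> X) -> X.

(* All operations of positive arity; the tag is the arity minus one. *)
Definition finop : Type := {n : nat & op n.+1}.

Implicit Types (C D : set finop).

Definition arity_part C (n : nat) : set (op n) :=
  match n with
  | 0 => set0
  | m.+1 => [set f : op m.+1 | C (existT (fun k => op k.+1) m f)]
  end.
Arguments arity_part C n : clear implicits.

Definition projection (n : nat) (k : 'I_n) : op n := fun x => x k.

Definition compose (n k : nat) (g : op k) (f : 'I_k -> op n) : op n :=
  fun x => g (fun i => f i x).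

Definition clone C : Prop :=
  (forall n (k : 'I_n), arity_part C n (projection k)) /\
  (forall n k (g : op k) (f : 'I_k -> op n),
     arity_part C k g -> (forall i, arity_part C n (f i)) ->
     arity_part C n (compose g f)).

Definition precomplete C : Prop :=
  [/\ clone C, C <> [set: finop] &
      forall D, clone D -> C `<` D -> D = [set: finop]].

Definition almost_unary (n : nat) (g : op n) : Prop :=
  exists (k : 'I_n) (G : X -> set X),
    (forall x, small (G x)) /\ (forall x : 'I_n -> X, G (x k) (g x)).

Definition almost_unary_ops : set finop :=
  [set f : finop | almost_unary (projT2 f)].

Definition Pol (m : nat) (F : set (op m)) : set finop :=
  [set f : finop | forall g : 'I_(projT1 f).+1 -> op m,
             (forall i, F (g i)) -> F (compose (projT2 f) g)].

End Clones.

Arguments arity_part {X} C n.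
Arguments almost_unary_ops X : clear implicits.

(* Main.v *)
Require Import Defs.
From mathcomp Require Import all_boot.
From mathcomp Require Import boolp classical_sets functions cardinality wochoice.

Local Open Scope classical_set_scope.

(** Since [Pol] of the almost unary binary operations is a clone, and a proper
one because some binary operation is not almost unary, precompleteness reduces
the theorem to one inclusion: every [f] in [C] maps almost unary binary
operations [g_i] to an almost unary operation ([sub_Pol_almost_unary]).

Suppose [F = f(g_1, ..., g_n)] is not almost unary. Then for each coordinate
[k] there is a line, obtained by fixing the [k]-th argument, on which [F] takes
a non-small set of values. Each [g_i] is controlled by one coordinate
[kappa i], so it takes few values on the line belonging to that coordinate. By
regularity, a non-small set of values cannot be split into few small pieces;
hence the line can be thinned out to a set [T k] on which every [g_i] with
[kappa i = k] is constant, say [g_i = c_i], while [F] still takes non-small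
many values ([thin_to_constant]). Now [C] contains the binary operation
[p(w) = f(u_1(w_(kappa 1)), ..., u_n(w_(kappa n)))], for any unary [u_i].
Choose [u_i] to take the value [c_i] at some base point and, at any other [v],
the value of [g_i] at a point of [T k'] where [F = v], with [k'] the coordinate
other than [kappa i]. Putting the base point in the coordinate [k] then turns
[p] into the identity on almost all of [F(T k)], so [p] takes non-small many
values on a line in either direction. This contradicts the hypothesis that the
binary operations of [C] are almost unary. *)

(** * Well-orders on a bare type *)

Definition strict {X : Type} (R : rel X) : X -> X -> Prop :=
  fun x y => R x y /\ x <> y.

Lemma well_order_min {X : Type} (R : rel X) (A : set X) (x : X) :
  well_order R -> A x -> exists2 z, A z & forall y, A y -> R z y.
Proof.
move=> Rwo Ax; have [|z [[Az minz] _]] := Rwo (fun y => `[< A y >]).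
  by exists x; apply/asboolP.
by exists z => [|y Ay]; [exact/asboolP | apply: minz; exact/asboolP].
Qed.

Lemma well_order_antisym {X : Type} (R : rel X) (x y : X) :
  well_order R -> R x y -> R y x -> x = y.
Proof.
move=> Rwo Rxy Ryx.
have Rrefl t : R t t.
  by have [z -> /(_ t erefl)] := well_order_min R [set t] t Rwo erefl.
have [|z [_ uniqz]] := Rwo (fun t => `[< t = x \/ t = y >]).
  by exists x; apply/asboolP; left.
by rewrite -(uniqz x) ?(uniqz y) //; split; [|move=> t /asboolP[]->| |
  move=> t /asboolP[]->]; rewrite ?Rrefl //; apply/asboolP; auto.
Qed.

Lemma strict_notR {X : Type} (R : rel X) (x y : X) :
  well_order R -> ~ R x y -> strict R y x.
Proof.
move=> Rwo nRxy; split; last first.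
  move=> yx; apply: nRxy; rewrite yx.
  by have [z -> /(_ x erefl)] := well_order_min R [set x] x Rwo erefl.
have [|z [->|->] minz] := well_order_min R [set x; y] x Rwo; first by left.
  by case: nRxy; apply: minz; right.
by apply: minz; left.
Qed.

Lemma strict_trans {X : Type} (R : rel X) (x y z : X) :
  well_order R -> strict R x y -> strict R y z -> strict R x z.
Proof.
move=> Rwo [Rxy xy] [Ryz yz]; split; last first.
  by move=> xz; apply/yz/(well_order_antisym R) => //; rewrite -xz.
have [|m [[->|->]|->] minm] :=
    well_order_min R [set x; y; z] x Rwo; first by left; left.
- by apply: minm; right.
- by case: xy; apply: (well_order_antisym R) => //; apply: minm; left; left.
- by case: yz; apply: (well_order_antisym R) => //; apply: minm; left; right.
Qed.

(** * Small sets *)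

Lemma card_le_small {X : Type} (A B : set X) :
  (A #<= B)%card -> small B -> small A.
Proof.
move=> leAB [_ neB]; split; first exact: card_leT.
apply: contra neB => /card_eqPle[_ leXA]; apply/card_eqPle.
by split; [exact: card_leT | exact: card_le_trans leXA leAB].
Qed.

Lemma sub_small {X : Type} (A B : set X) : A `<=` B -> small B -> small A.
Proof. by move=> /subset_card_le; exact: card_le_small. Qed.

Lemma not_small_setT (X : Type) : ~ small [set: X].
Proof. by case=> _; rewrite card_eqxx. Qed.

Lemma finite_small {X : Type} (A : set X) :
  regular_cardinality X -> finite_set A -> small A.
Proof.
move=> [infX _] finA; split; first exact: card_leT.
by apply/negP => /eq_finite_set eqA; apply: infX; rewrite -eqA.
Qed.

(** A small set is not cofinal, by regularity, and proper initial segments are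
small. In this form unions are handled by taking bounds of bounds, without any
arithmetic of cardinals. *)
Lemma small_bounded {X : Type} :
  regular_cardinality X ->
  exists2 R : rel X, well_order R &
    forall A : set X, small A <-> exists b, forall a, A a -> strict R a b.
Proof.
move=> [_ [R [Rwo segR] cofR]]; exists R => // A; split=> [[_ neA]|[b Ab]].
  apply: contrapT => unb; apply: (negP neA); apply: cofR => x.
  apply: contrapT => nx; apply: unb; exists x => a Aa.
  by apply: strict_notR => // Rxa; apply: nx; exists a.
by apply: sub_small (segR b) => a /Ab.
Qed.

(** The bounds of the pieces form a small set, so they are bounded in turn. *)
Lemma small_bigcup {X : Type} (I : set X) (S : X -> set X) :
  regular_cardinality X -> small I -> (forall c, small (S c)) ->
  small (\bigcup_(c in I) S c).
Proof.
move=> /small_bounded[R Rwo smallE] smallI smallS.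
have /choice[b bP] : forall c, exists b, forall a, S c a -> strict R a b.
  by move=> c; apply/smallE.
have /smallE[d dP] : small (b @` I).
  exact: card_le_small (card_image_le _ _) smallI.
apply/smallE; exists d => a [c Ic Sca].
by apply: strict_trans (bP _ _ Sca) (dP _ _) => //; exists c.
Qed.

Lemma small_setU {X : Type} (A B : set X) :
  regular_cardinality X -> small A -> small B -> small (A `|` B).
Proof.
move=> Xreg; have [R Rwo smallE] := small_bounded Xreg.
move=> /smallE[a aP] /smallE[b bP].
have /smallE[d dP] : small [set a; b].
  by apply: finite_small => //; rewrite finite_setU; split; exact: finite_set1.
apply/smallE; exists d => x [/aP|/bP] xlt.
  by apply: strict_trans xlt (dP _ _) => //; left.
by apply: strict_trans xlt (dP _ _) => //; right.
Qed.

(** The pigeonhole principle of a regular cardinal: otherwise [F @` T] would be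
the union of a small family of small sets. *)
Lemma not_small_fiber {X Z : Type} (F h : Z -> X) (T : set Z) :
  regular_cardinality X -> ~ small (F @` T) -> small (h @` T) ->
  exists c, ~ small (F @` (T `&` [set z | h z = c])).
Proof.
move=> Xreg nsF smallh; apply: contrapT => /forallNP all_small; apply: nsF.
have smallU := small_bigcup _ _ Xreg smallh (fun c => contrapT (all_small c)).
apply: sub_small smallU.
by move=> _ [z Tz <-]; exists (h z); [exists z | exists z].
Qed.

(** One application of the pigeonhole principle per function; treating the
functions in turn avoids bounding the number of tuples of values. *)
Lemma thin_to_constant {X Z : Type} {I : eqType} (s : seq I) (F : Z -> X)
    (h : I -> Z -> X) (T : set Z) :
  regular_cardinality X -> ~ small (F @` T) ->
  (forall i, i \in s -> small (h i @` T)) ->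
  exists T', [/\ T' `<=` T, ~ small (F @` T') &
    forall i, i \in s -> exists c, forall z, T' z -> h i z = c].
Proof.
move=> Xreg; elim: s T => [|i s IHs] T nsF smallh; first by exists T; split.
have [c nsc] := not_small_fiber F (h i) T Xreg nsF (smallh i (mem_head _ _)).
have [|T' [T'T nsT' constT']] := IHs _ nsc.
  move=> j js; apply: sub_small (smallh j _); last by rewrite in_cons js orbT.
  exact: image_subset.
exists T'; split=> // [z /T'T[]//|j]; rewrite in_cons => /orP[/eqP->|/constT'//].
by exists c => z /T'T[].
Qed.

(** * Almost unary operations *)

Definition hyperplane {X : Type} {n : nat} (k : 'I_n) (x : X) : set ('I_n -> X) :=
  [set z | z k = x].

(** The least candidate for the bounding family [G] is the family of the value
sets of [g] on the hyperplanes. *)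
Lemma almost_unaryP {X : Type} {n : nat} (g : op X n) :
  almost_unary g <-> exists k, forall x, small (g @` hyperplane k x).
Proof.
split=> [[k [G [smallG gG]]]|[k smallg]].
  by exists k => x; apply: sub_small (smallG x) => _ [z <- <-].
by exists k, (fun x => g @` hyperplane k x); split=> // z; exists z.
Qed.

Lemma almost_unary_projection {X : Type} {n : nat} (k : 'I_n) :
  regular_cardinality X -> almost_unary (@projection X n k).
Proof.
move=> Xreg; apply/almost_unaryP; exists k => x.
apply: (sub_small _ [set x]); first by move=> _ [z <- <-].
by apply: finite_small => //; exact: finite_set1.
Qed.

(** If [x0] is put in either argument, the operation below becomes the identity
in the other one. *)
Lemma exists_not_almost_unary (X : Type) :
  regular_cardinality X -> exists f : op X 2, ~ almost_unary f.
Proof.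
move=> [infX _].
have [x0 _] : [set: X] !=set0 by apply/set0P/eqP => X0; apply: infX; rewrite X0.
pose f : op X 2 := fun z => if pselect (z ord0 = x0) then z ord_max else z ord0.
exists f => /almost_unaryP[k smallf]; apply: (not_small_setT X).
apply: sub_small (smallf x0) => v _.
exists (fun j => if j == k then x0 else v); first by rewrite /hyperplane /= eqxx.
by rewrite /f; case: k {smallf} => -[|[|//]] lt_k2 /=; case: pselect.
Qed.

(** * Polymorphism clones *)

Lemma clone_Pol {X : Type} {m : nat} (F : set (op X m)) : clone (Pol F).
Proof.
split=> [[|n] k|[|n] [|k] g f // Pg Pf]; first by case: k.
- by move=> g Fg; exact: Fg.
- by have := Pf ord0.
- move=> h Fh; apply: (Pg (fun i => compose (f i) h)) => i.
  exact: Pf.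
Qed.

Lemma Pol_arity_part {X : Type} (n : nat) (F : set (op X n.+1)) :
  (forall k, F (projection k)) -> arity_part (Pol F) n.+1 `<=` F.
Proof. by move=> Fproj f /(_ _ Fproj). Qed.

(** * Preservation of the almost unary binary operations *)

Lemma eq_rev_ord2 (j k : 'I_2) : j <> k -> k = rev_ord j.
Proof.
by case: j k => -[|[|//]] ? [[|[|//]] ?] jk; apply: val_inj => //;
  case: jk; apply: val_inj.
Qed.

(** Two arguments are just enough to realise the failure of [F] inside [C]: a
unary [u i] only has to encode, besides the constant [c i], the points of the
one line that does not belong to the coordinate [kappa i]. *)
Lemma sub_Pol_almost_unary (X : Type) (C : set (finop X)) :
  regular_cardinality X -> clone C -> [set: op X 1] `<=` arity_part C 1 ->
  arity_part C 2 `<=` arity_part (almost_unary_ops X) 2 ->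
  C `<=` Pol (arity_part (almost_unary_ops X) 2).
Proof.
move=> Xreg [Cproj Ccomp] Cunary CU [n f] Cf g /= gU.
set F := compose f g; apply: contrapT => /almost_unaryP /forallNP Fbig.
have /choice[kappa kappaP] i := (almost_unaryP (g i)).1 (gU i).
have thin k : exists T, ~ small (F @` T) /\
    forall i, kappa i = k -> exists c, forall z, T z -> g i z = c.
  have [x nsF] := (existsNP _).2 (Fbig k).
  have [|T [_ nsT constT]] := thin_to_constant
      [seq i <- enum 'I_n.+1 | kappa i == k] F g (hyperplane k x) Xreg nsF.
    by move=> i; rewrite mem_filter => /andP[/eqP <- _].
  exists T; split=> // i ki; apply: constT.
  by rewrite mem_filter ki eqxx mem_enum.
have [T TP] := choice thin.
have /choice[c cP] i : exists c, forall z, T (kappa i) z -> g i z = c.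
  by case: (TP (kappa i)) => _; apply.
have [x0 _] : [set: X] !=set0.
  by apply/set0P/eqP => X0; case: Xreg; rewrite X0.
(* [rep k v] is a point of [T k] where [F] takes the value [v]; it is arbitrary
   when there is none. *)
have /choice[rep repP] (kv : 'I_2 * X) :
    exists z, (F @` T kv.1) kv.2 -> T kv.1 z /\ F z = kv.2.
  have [[z Tz Fz]|nFT] := pselect ((F @` T kv.1) kv.2); first by exists z.
  by exists (fun=> x0) => /nFT.
pose u i v :=
  if pselect (v = x0) then c i else g i (rep (rev_ord (kappa i), v)).
pose p : op X 2 := compose f (fun i w => u i (w (kappa i))).
have /CU/almost_unaryP[k smallp] : arity_part C 2 p.
  apply: (Ccomp 2 n.+1) => // i.
  apply: (Ccomp 2 1 (fun v => u i (v ord0)) (fun=> projection (kappa i))) => //.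
  exact: Cunary.
case: (TP k) => nsT _; apply: nsT.
(* The value [x0] is set apart because [p] may miss it: at [x0] the [u i] take
   the values [c i] in both arguments. *)
apply: (sub_small _ ([set x0] `|` p @` hyperplane k x0)); last first.
  by apply: small_setU => //; apply: finite_small => //; exact: finite_set1.
move=> v FTv; have [->|vx0] := pselect (v = x0); [by left | right].
have [Tz Fz] := repP (k, v) FTv.
exists (fun j => if j == k then x0 else v); first by rewrite /hyperplane /= eqxx.
apply: etrans Fz; rewrite /p /F /compose; congr f; apply: funext => i; rewrite /u.
case: eqP => [ki|/eq_rev_ord2 <-]; case: pselect => //= _.
by rewrite cP // ki.
Qed.

Theorem theorem3p6 (X : Type) (C : set (finop X))
  (X_regular : regular_cardinality X)
  (C_precomplete : precomplete C)
  (unary_sub_C : [set: op X 1] `<=` arity_part C 1)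
  (C2_sub_U2 : arity_part C 2 `<=` arity_part (almost_unary_ops X) 2) :
  C = Pol (arity_part (almost_unary_ops X) 2).
Proof.
have [C_clone _ C_max] := C_precomplete.
have C_sub := sub_Pol_almost_unary X C X_regular C_clone unary_sub_C C2_sub_U2.
apply/seteqP; split=> //; apply: contrapT => nsub.
have PolT := C_max _ (clone_Pol _) (conj C_sub nsub).
have [f] := exists_not_almost_unary X X_regular; apply.
apply: (Pol_arity_part 1 (arity_part (almost_unary_ops X) 2)).
  by move=> k; exact: almost_unary_projection.
by rewrite PolT.
Qed.
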